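(* The random graph, i.e. the Fraïssé limit $(\Gamma,R)$ of the class of all finite graphs, has no AZ-enumeration.
   Context: Graphs are structures with one symmetric irreflexive binary relation $R$. An AZ-enumeration of a countable first-order structure $M$ is a linear ordering $<$ of $M$ of order type $\omega$ such that for each $n$ and any sequence $\bar a_i$, $i\in\omega$, of $n$-tuples from $M$ there are $i\neq j$ in $\omega$ and an elementary map (elementary embedding) $\alpha:M\to M$ which is order preserving ($x<y$ implies $\alpha(x)<\alpha(y)$) and satisfies $\alpha(\bar a_i)=\bar a_j$. *)

(* Defs.v *)
From mathcomp Require Import all_boot.
From mathcomp Require Import boolp classical_sets functions cardinality.

Set Implicit Arguments.
Unset Strict Implicit.
Unset Printing Implicit Defensive.

Local Open Scope classical_set_scope.

Record signature := Signature {
  funsym : Type;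
  funsym_arity : funsym -> nat;
  relsym : Type;
  relsym_arity : relsym -> nat }.

Record structure (L : signature) := Structure {
  domain :> Type;
  fun_interp : forall f : funsym L, (funsym_arity f).-tuple domain -> domain;
  rel_interp : forall r : relsym L, (relsym_arity r).-tuple domain -> Prop }.

Arguments fun_interp {L} s f _.
Arguments rel_interp {L} s r _.

Section Syntax.
Variable L : signature.

Inductive term : Type :=
| Var of nat
| App (f : funsym L) of ('I_(funsym_arity f) -> term).

Inductive formula : Type :=
| FFalse
| FEq of term & term
| FRel (r : relsym L) of ('I_(relsym_arity r) -> term)
| FImp of formula & formula
| FAnd of formula & formula
| FOr of formula & formula
| FForall of nat & formula
| FExists of nat & formula.

End Syntax.

Section Semantics.
Variables (L : signature) (M : structure L).

Fixpoint eval (v : nat -> M) (t : term L) : M :=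
  match t with
  | Var i => v i
  | App f args => fun_interp M f [tuple eval v (args k) | k < funsym_arity f]
  end.

Definition update (v : nat -> M) (i : nat) (x : M) : nat -> M :=
  fun j => if j == i then x else v j.

Fixpoint sat (v : nat -> M) (phi : formula L) : Prop :=
  match phi with
  | FFalse => False
  | FEq s t => eval v s = eval v t
  | FRel r args =>
      rel_interp M r [tuple eval v (args k) | k < relsym_arity r]
  | FImp p q => sat v p -> sat v q
  | FAnd p q => sat v p /\ sat v q
  | FOr p q => sat v p \/ sat v q
  | FForall i p => forall x : M, sat (update v i x) p
  | FExists i p => exists x : M, sat (update v i x) p
  end.

End Semantics.

Definition elementary_embedding (L : signature) (M N : structure L)
    (alpha : M -> N) : Prop :=
  forall (phi : formula L) (v : nat -> M), sat v phi <-> sat (alpha \o v) phi.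

(* An order isomorphic to (nat, <) is automatically a strict linear order. *)
Definition order_type_omega (T : Type) (lt : T -> T -> Prop) : Prop :=
  exists e : nat -> T,
    bijective e /\ forall m n : nat, lt (e m) (e n) <-> (m < n)%N.

Definition AZ_enumeration (L : signature) (M : structure L)
    (lt : M -> M -> Prop) : Prop :=
  order_type_omega lt /\
  forall (n : nat) (a : nat -> n.-tuple M),
    exists i j : nat, i <> j /\
    exists alpha : M -> M,
      [/\ elementary_embedding alpha,
          forall x y : M, lt x y -> lt (alpha x) (alpha y) &
          map_tuple alpha (a i) = a j].

Section Embeddings.
Variables (L : signature) (M N : structure L).

Definition embedding (f : M -> N) : Prop :=
  [/\ injective f,
      forall (s : funsym L) (a : (funsym_arity s).-tuple M),
        f (fun_interp M s a) = fun_interp N s (map_tuple f a) &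
      forall (r : relsym L) (a : (relsym_arity r).-tuple M),
        rel_interp M r a <-> rel_interp N r (map_tuple f a)].

Definition isomorphism (f : M -> N) : Prop := embedding f /\ bijective f.

End Embeddings.

Section Substructures.
Variables (L : signature) (M : structure L).

Definition fun_closed (A : set M) : Prop :=
  forall (s : funsym L) (a : (funsym_arity s).-tuple M),
    (forall k, A (tnth a k)) -> A (fun_interp M s a).

Lemma fun_closed_val (A : set M) (clA : fun_closed A) (s : funsym L)
    (a : (funsym_arity s).-tuple A) :
  fun_interp M s (map_tuple val a) \in A.
Proof.
by apply/mem_set/clA => k; rewrite tnth_map; apply/set_mem/valP.
Qed.

Definition substructure (A : set M) (clA : fun_closed A) : structure L :=
  @Structure L A
    (fun s a => exist _ (fun_interp M s (map_tuple val a))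
                        (fun_closed_val clA a))
    (fun r a => rel_interp M r (map_tuple val a)).

Definition finitely_generated : Prop :=
  exists S : set M, finite_set S /\
    forall A : set M, fun_closed A -> S `<=` A -> A = [set: M].

End Substructures.

Definition ultrahomogeneous (L : signature) (M : structure L) : Prop :=
  forall (A B : set M) (clA : fun_closed A) (clB : fun_closed B),
    finitely_generated (substructure clA) ->
    finitely_generated (substructure clB) ->
    forall f : substructure clA -> substructure clB,
      isomorphism f ->
      exists h : M -> M, isomorphism h /\
        forall x : substructure clA, h (val x) = val (f x).

Definition age (L : signature) (M A : structure L) : Prop :=
  finitely_generated A /\ exists f : A -> M, embedding f.

Definition fraisse_limit (L : signature) (K : structure L -> Prop)
    (M : structure L) : Prop :=
  [/\ countable [set: M],
      ultrahomogeneous M &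
      forall A : structure L, age M A <-> K A].

Definition graph_signature : signature :=
  @Signature void (fun _ => 0%N) unit (fun _ => 2%N).

Definition adj (G : structure graph_signature) (x y : G) : Prop :=
  rel_interp G tt [tuple x; y].

Definition is_graph (G : structure graph_signature) : Prop :=
  (forall x y : G, adj x y -> adj y x) /\ (forall x : G, ~ adj x x).

Definition finite_graph (G : structure graph_signature) : Prop :=
  is_graph G /\ finite_set [set: G].

Definition random_graph : structure graph_signature -> Prop :=
  fraisse_limit finite_graph.

(* Main.v *)
From mathcomp Require Import all_boot.
From mathcomp Require Import boolp classical_sets cardinality.
Require Import Defs.

(** Let [e 0, e 1, ...] list the random graph in the given order.  By the
    extension property there is an increasing induced path
    [e (x 0), e (x 1), ...], and for every [n] a vertex [e (d n)] whose
    neighbours among [e 0, ..., e (x n)] are exactly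
    [e (x 0), ..., e (x n)].  An order preserving elementary map sending
    [(x 0, x n, d n)] to [(x 0, x m, d m)] maps the path [x 0, ..., x n] into
    the path [x 0, ..., x m]; as it fixes [x 0], respects the order and
    preserves adjacency, it fixes [x 1, ..., x n] one after the other.  Hence
    [x n = x m] and [n = m]. *)

Set Implicit Arguments.
Unset Strict Implicit.
Unset Printing Implicit Defensive.

Local Open Scope classical_set_scope.

Section Graphs.

Implicit Types G H : structure graph_signature.

Lemma adj_tuple G (r : relsym graph_signature) (a : (relsym_arity r).-tuple G) :
  rel_interp G r a = adj (tnth a ord0) (tnth a ord_max).
Proof.
case: r a => a; rewrite /adj; congr rel_interp.
apply: eq_from_tnth => -[[|[|//]] ltk] /=; rewrite [RHS](tnth_nth (tnth a ord0)) /=;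
  by congr tnth; apply: val_inj.
Qed.

Lemma embeddingP G H (f : G -> H) :
  embedding f <-> injective f /\ forall x y, adj x y <-> adj (f x) (f y).
Proof.
split=> [[finj _ frel]|[finj fadj]].
  split=> // x y; have := frel tt [tuple x; y].
  by rewrite (adj_tuple (map_tuple _ _)) !tnth_map.
by split=> [||r a]; [| case | rewrite !adj_tuple !tnth_map; apply: fadj].
Qed.

Lemma elementary_embedding_adj G H (f : G -> H) :
  elementary_embedding f -> forall x y, adj x y <-> adj (f x) (f y).
Proof.
move=> fel x y.
(* The atomic formula $R(v_0,v_1)$, under the assignment sending $v_0$ to [x] and all other
   variables to [y]. *)
have := fel (@FRel graph_signature tt (fun k => Var _ k))
  (fun k => if k is 0 then x else y).
by rewrite /sat !adj_tuple !tnth_mktuple.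
Qed.

Lemma fun_closed_graph G (A : set G) : fun_closed A.
Proof. by case. Qed.

Definition induced G (A : set G) := substructure (fun_closed_graph (A := A)).

Lemma adj_induced G (A : set G) (x y : induced A) :
  adj x y <-> adj (val x) (val y).
Proof. by rewrite {1}/adj /= adj_tuple !tnth_map. Qed.

Lemma finitely_generated_finite (L : signature) (M : structure L) :
  finite_set [set: M] -> finitely_generated M.
Proof.
by move=> finM; exists [set: M]; split=> // A _ subA; apply/seteqP; split.
Qed.

Definition range_pt G (I : Type) (u : I -> G) (i : I) : induced (range u) :=
  exist _ (u i) (mem_set (imageT u i)).

Lemma range_ptP G (I : Type) (u : I -> G) (x : induced (range u)) :
  exists i, x = range_pt u i.
Proof.
case: x => x xA; have [i _ ui] := set_mem xA.
by exists i; apply: val_inj; rewrite /= ui.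
Qed.

Lemma finitely_generated_range G (I : finType) (u : I -> G) :
  finitely_generated (induced (range u)).
Proof.
apply: finitely_generated_finite.
apply: (sub_finite_set (B := range (range_pt u))).
  by move=> x _; have [i ->] := range_ptP x; apply: imageT.
exact/finite_image/finite_finset.
Qed.

(** Homogeneity for finite families instead of substructures: injectivity of [u] makes $u_i \mapsto
    v_i$ a well-defined map between the induced subgraphs on the two ranges. *)
Lemma ultrahomogeneous_extend G (I : finType) (u v : I -> G) :
  ultrahomogeneous G -> injective u -> injective v ->
  (forall i j, adj (u i) (u j) <-> adj (v i) (v j)) ->
  exists h : G -> G, isomorphism h /\ forall i, h (u i) = v i.
Proof.
move=> homG uinj vinj uv.
have [fu fuK] := choice (@range_ptP G I u).
have [fv fvK] := choice (@range_ptP G I v).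
have fuE i : fu (range_pt u i) = i.
  by apply: uinj; have /(congr1 val) := fuK (range_pt u i).
have fvE i : fv (range_pt v i) = i.
  by apply: vinj; have /(congr1 val) := fvK (range_pt v i).
pose f x := range_pt v (fu x).
have fbij : bijective f.
  by exists (fun y => range_pt u (fv y)) => x; rewrite /f ?fvE ?fuE -?fuK -?fvK.
have fiso : isomorphism f.
  split=> //; apply/embeddingP; split; first exact: bij_inj.
  by move=> x y; rewrite (fuK x) (fuK y) /f !fuE !adj_induced; apply: uv.
have [h [hiso hE]] := homG _ _ _ _ (finitely_generated_range u)
  (finitely_generated_range v) f fiso.
by exists h; split=> // i; have := hE (range_pt u i); rewrite /f fuE.
Qed.

Definition graph_of (T : Type) (E : T -> T -> Prop) : structure graph_signature :=
  @Structure graph_signature T (fun s _ => match s with end)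
    (fun _ a => E (tnth a ord0) (tnth a ord_max)).

Lemma adj_graph_of (T : Type) (E : T -> T -> Prop) (x y : graph_of E) :
  adj x y = E x y.
Proof. by []. Qed.

(** Both graph axioms mention at most two vertices, and any two vertices span an induced
    substructure in the age, hence a finite graph. *)
Lemma random_graph_is_graph G : random_graph G -> is_graph G.
Proof.
move=> [_ _ ageG].
have graph_range (u : bool -> G) : is_graph (induced (range u)).
  suff /ageG[] : age G (induced (range u)) by [].
  split; first exact: finitely_generated_range.
  exists val; apply/embeddingP.
  by split; [exact: val_inj | exact: adj_induced].
split=> [x y|x].
  have [sym _] := graph_range (fun b => if b then x else y).
  by have := sym (range_pt _ true) (range_pt _ false); rewrite !adj_induced.
have [_ irr] := graph_range (fun=> x).
by have := irr (range_pt _ true); rewrite adj_induced.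
Qed.

(** Adjoin to the graph on [I] a vertex [None] with neighbourhood [P]. This finite graph embeds into
    [G] by some [f]; an automorphism taking each [u i] to [f (Some i)] pulls [f None] back to the
    required [z]. *)
Lemma random_graph_extension G (I : finType) (u : I -> G) (P : I -> Prop) :
  random_graph G -> injective u ->
  exists z, (forall i, z <> u i) /\ forall i, adj z (u i) <-> P i.
Proof.
move=> randG uinj; have [adjC adj_irr] := random_graph_is_graph randG.
case: randG => _ homG ageG.
pose E (a b : option I) : Prop :=
  match a, b with
  | Some i, Some j => adj (u i) (u j)
  | Some i, None | None, Some i => P i
  | None, None => False
  end.
have /ageG[_ [f /embeddingP[finj fadj]]] : finite_graph (graph_of E).
  split; last exact: (@finite_finset (option I)).
  split=> [a b|a]; rewrite !adj_graph_of.
    by case: a b => [i|] [j|] //=; exact: adjC.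
  by case: a => [i|] //=; exact: adj_irr.
have [h [[/embeddingP[hinj hadj] [h' hK h'K]] hE]] :
    exists h : G -> G, isomorphism h /\ forall i, h (u i) = f (Some i).
  apply: ultrahomogeneous_extend => // [i j /finj[]//|i j].
  exact: (fadj (Some i) (Some j)).
exists (h' (f None)); split=> i.
  by move=> /(congr1 h); rewrite h'K hE => /finj.
by rewrite hadj h'K hE -fadj.
Qed.

End Graphs.

Theorem proposition1p2 (Gamma : structure graph_signature)
    (Gamma_random : random_graph Gamma) :
  ~ exists lt : Gamma -> Gamma -> Prop, AZ_enumeration lt.
Proof.
move=> [lt [[e [e_bij ltE]] AZ]].
have e_inj := bij_inj e_bij.
have [e' eK e'K] := e_bij.
have [adjC _] := random_graph_is_graph Gamma_random.
(* The new vertex differs from [e 0], ..., [e (N-1)], so its index is at least [N]. Pairing [N] with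
   [P] lets [choice] produce a single function [w]. *)
have ext (NP : nat * (nat -> Prop)) : exists m, (NP.1 <= m)%N /\
    forall i, (i < NP.1)%N -> adj (e m) (e i) <-> NP.2 i.
  case: NP => N P /=.
  have [z [zNe zP]] := @random_graph_extension Gamma 'I_N
    (fun i => e i) (fun i => P i) Gamma_random (inj_comp e_inj val_inj).
  exists (e' z); rewrite e'K; split=> [|i ltiN]; last exact: (zP (Ordinal ltiN)).
  by rewrite leqNgt; apply/negP => ltzN; apply: (zNe (Ordinal ltzN)); rewrite /= e'K.
have [w wP] := choice ext.
(* Among the vertices of index at most [x n], the next one is adjacent to [e (x n)] only. *)
pose x n := iter n (fun k => w (k.+1, eq^~ k)) 0%N.
have x_step n : (x n < x n.+1)%N by have [] := wP ((x n).+1, eq^~ (x n)).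
have x_mono : {mono x : i j / (i <= j)%N}.
  by apply: leq_mono; apply: homo_ltn x_step; exact: ltn_trans.
have ltx := leqW_mono x_mono.
have x_adj i j : (i < j)%N -> adj (e (x j)) (e (x i)) <-> j = i.+1.
  case: j => // j; rewrite ltnS => leij.
  have [_ /(_ (x i))] := wP ((x j).+1, eq^~ (x j)).
  rewrite ltnS x_mono => /(_ leij) ->.
  by split=> [/(incn_inj x_mono)->|[->]].
pose d n := w ((x n).+1, fun k => exists2 i, (i <= n)%N & k = x i).
have d_adj n k : (k <= x n)%N ->
    adj (e (d n)) (e k) <-> exists2 i, (i <= n)%N & k = x i.
  by move=> lek; apply: (wP (_, _)).2.
have [n [m [neq_nm [alpha [alpha_el alpha_lt alphaE]]]]] :=
  AZ 3%N (fun n => [tuple e (x 0%N); e (x n); e (d n)]).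
have [alpha0 alphax alphad] : [/\ alpha (e (x 0%N)) = e (x 0%N),
    alpha (e (x n)) = e (x m) & alpha (e (d n)) = e (d m)].
  by have /(congr1 val)[-> -> ->] := alphaE.
have alpha_adj := elementary_embedding_adj alpha_el.
have fixed i : (i <= n)%N -> alpha (e (x i)) = e (x i).
  elim: i => // i IHi ltin; have alphai := IHi (ltnW ltin).
  have [k alphaS] : exists k, alpha (e (x i.+1)) = e k.
    by exists (e' (alpha (e (x i.+1)))); rewrite e'K.
  (* The neighbours of [e (d m)] are controlled only up to index [x m]; monotonicity of [alpha]
     keeps the image within that range. *)
  have lekm : (k <= x m)%N.
    have: (x i.+1 <= x n)%N by rewrite x_mono.
    rewrite leq_eqVlt => /orP[/eqP xE|/ltE/alpha_lt].
      by move: alphaS; rewrite xE alphax => /e_inj <-.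
    by rewrite alphaS alphax ltE => /ltnW.
  have /(d_adj _ _ lekm)[j _ kE] : adj (e (d m)) (e k).
    rewrite -alphaS -alphad -alpha_adj d_adj ?x_mono //; by exists i.+1.
  (* The image is now some [e (x j)] on the path. Order excludes the predecessor of [x i], the only
     other path vertex that could be adjacent to it, so $j = i+1$. *)
  have ltij : (i < j)%N.
    have /ltE/alpha_lt := x_step i.
    by rewrite alphai alphaS kE ltE ltx.
  have /(x_adj _ _ ltij) jE : adj (e (x j)) (e (x i)).
    by rewrite -kE -alphaS -alphai -alpha_adj x_adj.
  by rewrite alphaS kE jE.
apply: neq_nm; apply: (incn_inj x_mono); apply: e_inj.
by rewrite -alphax fixed.
Qed.
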